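(* There exist absolute constants $C_{\rm tr}>0$ and $c_{\rm sp}>0$ such that the following holds. For every positive integer $n$, let $\Omega_n$ be a finite set and let $\mathcal A_n\subseteq\binom{\Omega_n}{h_n}$, where $h_n\to\infty$. Let $\vartheta_n\in(0,1]$ and let $$a_n=\mathbb P[(\Omega_n)_{\vartheta_n}\text{ contains a member of }\mathcal A_n].$$ Suppose that $a_n>0$ for every $n$ and that $q_n:=\vartheta_n/a_n\le 1/2$ for all sufficiently large $n$. Then: (1) $\mathcal A_n$ supports a $q_n$-spread measure. (2) Upon colouring the members of $\Omega_n$ independently and uniformly using the palette $[h_n]$, $$\mathbb P[(\Omega_n)_{\rho_n}\text{ admits a rainbow member of }\mathcal A_n]=1-o(1)$$ holds whenever $\rho_n\in(0,1]$ satisfies $\rho_n\ge 2C_{\rm tr}\,q_n\log h_n$, where the probability is over both the colouring and the $\rho_n$-percolation. (3) In particular, whenever $q_n\log h_n\le c_{\rm sp}$ for all sufficiently large $n$, an independent uniform colouring of $\Omega_n$ from $[h_n]$ a.a.s. admits a rainbow member of $\mathcal A_n$.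
   Context: $\binom{\Omega}{h}$ is the family of $h$-element subsets of $\Omega$; $[h]=\{1,\dots,h\}$; $\log$ is the natural logarithm. For a finite set $\Omega$ and $\rho\in[0,1]$, the random set $\Omega_\rho$ retains each element of $\Omega$ independently with probability $\rho$. The final percolation $(\Omega_n)_{\rho_n}$ is sampled from $\Omega_n$ independently of the colouring. For $S\subseteq\Omega$ write $\langle S\rangle=\{A\subseteq\Omega:S\subseteq A\}$. For $q>0$, a probability measure $\mu$ on $2^\Omega$ is $q$-spread if $\mu(\langle S\rangle)\le q^{|S|}$ for every $S\subseteq\Omega$; a family $\mathcal A\subseteq2^\Omega$ supports such a measure if $\mu(\mathcal A)=1$. A member of $\mathcal A_n$ is rainbow if its elements receive pairwise distinct colours; a random set admits/contains a member if the member is a subset of it. Asymptotics are as $n\to\infty$, and a.a.s. means with probability tending to $1$. *)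

(* Defs.v *)
From mathcomp Require Import all_boot all_order all_algebra.
From mathcomp Require Import all_classical all_reals all_analysis.

Set Implicit Arguments.
Unset Strict Implicit.
Unset Printing Implicit Defensive.

Import Order.TTheory GRing.Theory Num.Theory.
Import numFieldNormedType.Exports.

Local Open Scope ring_scope.

(* Probability measures on a finite type are given by their mass functions. *)

Definition is_pmf (R : realType) (T : finType) (mu : {ffun T -> R}) : Prop :=
  (forall x, 0 <= mu x) /\ \sum_x mu x = 1.

Definition Pr (R : realType) (T : finType) (mu : {ffun T -> R}) (E : pred T) : R :=
  \sum_(x | E x) mu x.

Definition prod_pmf (R : realType) (T U : finType)
    (mu : {ffun T -> R}) (nu : {ffun U -> R}) : {ffun T * U -> R} :=
  [ffun z => mu z.1 * nu z.2].

Definition percolation (R : realType) (T : finType) (rho : R) : {ffun {set T} -> R} :=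
  [ffun W : {set T} => \prod_(x : T) (if x \in W then rho else 1 - rho)].

(* For h = 0 and T inhabited there is no colouring, and this is not a
   probability measure. *)
Definition uniform_colouring (R : realType) (T : finType) (h : nat) :
    {ffun {ffun T -> 'I_h} -> R} :=
  [ffun _ => \prod_(x : T) h%:R^-1].

Definition spread (R : realType) (T : finType) (q : R) (mu : {ffun {set T} -> R}) : Prop :=
  forall S : {set T}, Pr mu (fun A => S \subset A) <= q ^+ #|S|.

Definition supports_spread (R : realType) (T : finType)
    (F : {set {set T}}) (q : R) : Prop :=
  exists mu : {ffun {set T} -> R},
    [/\ is_pmf mu, Pr mu (fun A => A \in F) = 1 & spread q mu].

Definition contains_member (T : finType) (F : {set {set T}}) (W : {set T}) : bool :=
  [exists A in F, A \subset W].

Definition rainbow (T C : finType) (c : {ffun T -> C}) (A : {set T}) : bool :=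
  dinjectiveb c A.

Definition contains_rainbow (T C : finType) (F : {set {set T}})
    (c : {ffun T -> C}) (W : {set T}) : bool :=
  [exists A in F, (A \subset W) && rainbow c A].

Lemma percolation_pmf (R : realType) (T : finType) (rho : R) :
  0 <= rho <= 1 -> is_pmf (percolation T rho).
Proof.
case/andP=> r0 r1; split=> [W|].
  by rewrite ffunE; apply: prodr_ge0 => x _; case: ifP => // _; rewrite subr_ge0.
have := @bigA_distr R 0 1 *%R +%R T (fun=> rho) (fun=> 1 - rho).
rewrite big1 => [->|x _]; last by rewrite /= addrCA subrr addr0.
by apply: eq_bigr => W _; rewrite ffunE.
Qed.

Lemma uniform_colouring_pmf (R : realType) (T : finType) (h : nat) :
  (0 < h)%N -> is_pmf (uniform_colouring R T h).
Proof.
move=> h0; split=> [c|]; first by rewrite ffunE; apply: prodr_ge0 => x _; rewrite invr_ge0.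
under eq_bigr do rewrite ffunE prodr_const.
rewrite sumr_const card_ffun card_ord -[LHS]mulr_natr natrX -exprMn mulVf ?expr1n //.
by rewrite pnatr_eq0 -lt0n.
Qed.

Lemma prod_pmf_pmf (R : realType) (T U : finType)
    (mu : {ffun T -> R}) (nu : {ffun U -> R}) :
  is_pmf mu -> is_pmf nu -> is_pmf (prod_pmf mu nu).
Proof.
move=> [mu0 mu1] [nu0 nu1]; split=> [z|]; first by rewrite ffunE mulr_ge0.
rewrite (eq_bigr (fun z => mu z.1 * nu z.2)) => [|z _]; last by rewrite ffunE.
rewrite -(pair_bigA _ (fun x y => mu x * nu y)) /= -[RHS]mu1.
by apply: eq_bigr => x _; rewrite -big_distrr /= nu1 mulr1.
Qed.

(* Main.v *)
Require Import Defs.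
From mathcomp Require Import all_boot all_order all_algebra.
From mathcomp Require Import all_classical all_reals all_analysis.
From mathcomp Require Import ring lra zify perm.
Import Order.TTheory GRing.Theory Num.Theory.
Import numFieldNormedType.Exports.
Local Open Scope ring_scope.

(* Conditioning the theta-percolation on containing a member and selecting one
   inside it gives the spread measure mu. For the rainbow statement, give a
   mu-random member A a uniformly random bijection to the palette [h]: its graph
   is a random h-subset of Omega x [h] which is (e q / h)-spread. A random subset
   of Omega x [h] of density of order (q / h) log h contains such a graph, by
   Park and Pham's fragment argument: each round of density 8 e q / h halves all
   fragments up to a set of small weight, and one last round finishes once the
   fragments have bounded size. A graph uses one colour per vertex, so replacing
   the random list of colours of a vertex by one uniform colour kept with
   probability rho can only help; hence a coloured rho-percolation contains a
   rainbow member. *)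

(** * Probabilities of events under a mass function *)

Lemma Pr_pred (R : realType) (T : finType) (mu : {ffun T -> R}) (E : pred T) :
  Pr mu E = \sum_x mu x * (E x)%:R.
Proof. by rewrite /Pr big_mkcond; apply: eq_bigr => x _; case: (E x); rewrite ?mulr1 ?mulr0. Qed.

Lemma Pr_le (R : realType) (T : finType) (mu : {ffun T -> R}) (E E' : pred T) :
  (forall x, 0 <= mu x) -> (forall x, E x -> E' x) -> Pr mu E <= Pr mu E'.
Proof.
move=> mu0 EE'; rewrite /Pr big_mkcond [leRHS]big_mkcond; apply: ler_sum => x _.
by case: ifP => [/EE' ->//|_]; case: ifP.
Qed.

Lemma Pr_le1 (R : realType) (T : finType) (mu : {ffun T -> R}) (E : pred T) :
  is_pmf mu -> Pr mu E <= 1.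
Proof. by case=> mu0 <-; rewrite -[leRHS]/(Pr mu predT); apply: Pr_le. Qed.

(** * Product measures *)

Section Products.
Variables (R : realType) (X : finType).
Implicit Types V U : finType.

Definition prodE V (m : X -> V -> R) (phi : {ffun X -> V} -> R) : R :=
  \sum_(f : {ffun X -> V}) (\prod_x m x (f x)) * phi f.

Lemma prodE_push V U (m : X -> V -> R) (f : V -> U) (phi : {ffun X -> U} -> R) :
  prodE V m (fun v => phi [ffun x => f (v x)]) =
  prodE U (fun x u => \sum_(v | f v == u) m x v) phi.
Proof.
rewrite /prodE (partition_big (fun v : {ffun X -> V} => [ffun x => f (v x)]) predT) //=.
apply: eq_bigr => u _; rewrite bigA_distr_big_dep mulr_suml.
apply: eq_big => [v|v /eqP <-//].
apply/eqP/forallP => [<- x|H]; first by rewrite unfold_in /= ffunE.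
by apply/ffunP => x; rewrite ffunE; apply/eqP; have := H x; rewrite unfold_in /=.
Qed.

Definition upd V (f : {ffun X -> V}) (x : X) (v : V) : {ffun X -> V} :=
  [ffun y => if y == x then v else f y].

(* Exchanging [f x] with a fresh sample [v] is an involution on pairs [(f, v)]. *)
Lemma prodE_resample V (m : X -> V -> R) (x : X) (n : V -> R) phi :
  \sum_v n v = 1 ->
  prodE V m phi =
  \sum_(f : {ffun X -> V}) ((\prod_(y | y != x) m y (f y)) * n (f x)) *
    \sum_v m x v * phi (upd V f x v).
Proof.
move=> n1; under [RHS]eq_bigr do rewrite mulr_sumr.
rewrite pair_bigA /=.
pose s (z : {ffun X -> V} * V) := (upd V z.1 x z.2, z.1 x).
have sK : involutive s.
  move=> [f v]; rewrite /s /=; congr pair; last by rewrite /upd ffunE eqxx.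
  by apply/ffunP => y; rewrite /upd !ffunE; case: eqP => [->|].
rewrite (reindex_inj (inv_inj sK)) /=.
transitivity (\sum_(f : {ffun X -> V}) \sum_v n v * (\prod_y m y (f y) * phi f)).
  by apply: eq_bigr => f _; rewrite -mulr_suml n1 mul1r.
rewrite pair_bigA; apply: eq_bigr => -[f v] _ /=.
have -> : upd V (upd V f x v) x (f x) = f.
  by apply/ffunP => y; rewrite /upd !ffunE; case: eqP => [->|].
rewrite {1}/upd ffunE eqxx (bigD1 x) //=.
have -> : \prod_(y | y != x) m y (upd V f x v y) = \prod_(y | y != x) m y (f y).
  by apply: eq_bigr => y /negPf yx; rewrite /upd ffunE yx.
ring.
Qed.

(** A hybrid argument: the coordinates pass from [m] to [m'] one at a time, and resampling isolates
    the one that changes. *)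
Lemma prodE_dom V (m m' : X -> V -> R) phi :
  (forall x v, 0 <= m x v) -> (forall x v, 0 <= m' x v) ->
  (forall x, \sum_v m' x v = 1) ->
  (forall x f, \sum_v m x v * phi (upd V f x v) <= \sum_v m' x v * phi (upd V f x v)) ->
  prodE V m phi <= prodE V m' phi.
Proof.
move=> m0 m'0 m'1 H.
pose mix (s : seq X) x v := if x \in s then m' x v else m x v.
suff K s : uniq s -> prodE V m phi <= prodE V (mix s) phi.
  have := K _ (enum_uniq X); congr (_ <= _).
  apply: eq_bigr => f _; congr (_ * _); apply: eq_bigr => x _.
  by rewrite /mix mem_enum inE.
elim: s => [_|x s IH /= /andP[xs us]].
  rewrite le_eqVlt; apply/orP; left; apply/eqP.
  by apply: eq_bigr => f _; congr (_ * _).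
apply: le_trans (IH us) _.
(* Taking [m' x] as auxiliary law on both sides makes the outer weights equal, so only the inner
   sums over [v] remain to be compared. *)
rewrite (prodE_resample _ _ x (m' x)) // [leRHS](prodE_resample _ _ x (m' x)) //.
apply: ler_sum => f _.
have -> : \prod_(y | y != x) mix (x :: s) y (f y) =
          \prod_(y | y != x) mix s y (f y).
  by apply: eq_bigr => y /negPf yx; rewrite /mix inE yx.
apply: ler_wpM2l.
  by rewrite mulr_ge0// prodr_ge0// => y _; rewrite /mix; case: ifP.
have -> : mix s x = m x by apply/funext => v; rewrite /mix (negPf xs).
have -> : mix (x :: s) x = m' x by apply/funext => v; rewrite /mix mem_head.
exact: H.
Qed.

End Products.

(** * Percolation as a product of Bernoulli laws *)

Section Percolation.
Variables (R : realType).

Lemma percolation_ge0 (X : finType) (p : R) W : 0 <= p <= 1 -> 0 <= percolation X p W.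
Proof. by case/(percolation_pmf X) => H _; apply: H. Qed.

Lemma sum_percolation (X : finType) (p : R) : 0 <= p <= 1 -> \sum_W percolation X p W = 1.
Proof. by case/(percolation_pmf X). Qed.

Lemma Pr_percolation_sup (X : finType) (p : R) (S : {set X}) :
  Pr (percolation X p) (fun W => S \subset W) = p ^+ #|S|.
Proof.
(* Absence has weight zero on [S], so the expanded product keeps exactly the sets containing [S]. *)
have := @bigA_distr R 0 1 *%R +%R X (fun=> p) (fun x => if x \in S then 0 else 1 - p).
have -> : \prod_x (p + (if x \in S then 0 else 1 - p)) = p ^+ #|S|.
  rewrite -prodr_const [RHS]big_mkcond /=; apply: eq_bigr => x _.
  by case: ifP => _; rewrite ?addr0 // addrC subrK.
move=> ->; rewrite /Pr big_mkcond /=; apply: eq_bigr => W _.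
case: ifP => [/fintype.subsetP SW|/negbT].
  rewrite ffunE; apply: eq_bigr => x _; case: ifP => // /negbT xW.
  by rewrite (negPf (contra (SW x) xW)).
case/subsetPn => x xS /negPf xW.
by rewrite (bigD1 x) //= xW xS mul0r.
Qed.

Definition bern (p : R) (b : bool) := if b then p else 1 - p.

Lemma percolation_prodE (X : finType) (p : R) (phi : {set X} -> R) :
  \sum_W percolation X p W * phi W =
  prodE R X bool (fun=> bern p) (fun f => phi [set x | f x]%SET).
Proof.
rewrite /prodE (reindex (fun f : {ffun X -> bool} => [set x | f x]%SET)) /=.
  apply: eq_bigr => f _; rewrite ffunE; congr (_ * _).
  by apply: eq_bigr => x _; rewrite inE.
exists (fun W : {set X} => [ffun x => x \in W]) => [f _|W _].
  by apply/ffunP => x; rewrite ffunE inE.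
by apply/setP => x; rewrite inE ffunE.
Qed.

(** The union of the two samples is a percolation of density [1 - (1 - p1) * (1 - p2)], at most
    [p1 + p2], and a decreasing [phi] has larger mean at smaller density. *)
Lemma percolation_union (X : finType) (p1 p2 : R) (phi : {set X} -> R) :
  0 <= p1 -> 0 <= p2 -> p1 + p2 <= 1 ->
  (forall A B : {set X}, A \subset B -> phi B <= phi A) ->
  \sum_W percolation X (p1 + p2) W * phi W <=
  \sum_W1 percolation X p1 W1 * \sum_W2 percolation X p2 W2 * phi (W1 :|: W2).
Proof.
move=> p10 p20 p12 phi_dec.
have p11 : p1 <= 1 by apply: le_trans p12; rewrite lerDl.
have p21 : p2 <= 1 by apply: le_trans p12; rewrite lerDr.
pose m2 (x : X) (b : bool * bool) := bern p1 b.1 * bern p2 b.2.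
pose phi' (f : {ffun X -> bool}) := phi [set x | f x]%SET.
have -> : \sum_W1 percolation X p1 W1 * (\sum_W2 percolation X p2 W2 * phi (W1 :|: W2)) =
  prodE R X _ m2 (fun f => phi' [ffun x => (f x).1 || (f x).2]).
  under eq_bigr do rewrite mulr_sumr.
  rewrite pair_bigA /prodE.
  rewrite (reindex (fun f : {ffun X -> bool * bool} =>
    ([set x | (f x).1]%SET, [set x | (f x).2]%SET))) /=.
    apply: eq_bigr => f _; rewrite !ffunE mulrA -big_split /=; congr (_ * _).
      by apply: eq_bigr => x _; rewrite !inE.
    by rewrite /phi'; congr phi; apply/setP => x; rewrite !inE ffunE.
  exists (fun W : {set X} * {set X} => [ffun x => (x \in W.1, x \in W.2)]) => [f _|[W1 W2] _].
    by apply/ffunP => x; rewrite ffunE !inE; case: (f x).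
  by congr pair; apply/setP => x; rewrite inE ffunE.
rewrite percolation_prodE (prodE_push R X _ _ m2 (fun b => b.1 || b.2)).
have b0 p b : 0 <= p <= 1 -> 0 <= bern p b.
  by case/andP => ? ?; rewrite /bern; case: b; rewrite ?subr_ge0.
have pushE x b : \sum_(v | v.1 || v.2 == b) m2 x v =
    bern (1 - (1 - p1) * (1 - p2)) b.
  rewrite big_mkcond -(pair_bigA _ (fun i j => if i || j == b then m2 x (i, j) else 0)) /=.
  rewrite !big_bool /= /m2 /bern /=; case: b => /=; ring.
apply: prodE_dom => [x v|x v|x|x f].
- by apply: b0; rewrite p12 addr_ge0.
- by apply: sumr_ge0 => b _; rewrite mulr_ge0 ?b0 ?p10 ?p20.
- by rewrite big_bool /= !pushE /bern; ring.
rewrite !big_bool /= !pushE /bern.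
(* [a] is the value with [x] present and [b] with [x] absent; the two densities differ by
   [p1 * p2]. *)
set a := phi _; set b := phi _.
have ab : a <= b.
  by apply: phi_dec; apply/fintype.subsetP => y; rewrite /upd !inE !ffunE; case: eqP.
have := mulr_ge0 p10 p20; nra.
Qed.

End Percolation.

(** * Fragments and the spread lemma *)

Section Fragments.
Variables (X I : finType) (D : {set I}) (g : I -> {set X}) (W : {set X}).

(* Park and Pham's minimum fragment of [g i] with respect to [W]. *)
Definition frag (i : I) : {set X} :=
  g [arg min_(j < i | (j \in D) && (g j \subset g i :|: W)) #|g j :\: W|] :\: W.

Lemma fragE i : i \in D -> exists2 j, j \in D & frag i = g j :\: W.
Proof.
move=> iD; rewrite /frag; case: arg_minnP => [|j /andP[jD _] _].
  by rewrite iD finset.subsetUl.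
by exists j.
Qed.

Lemma frag_sub i : i \in D -> frag i \subset g i.
Proof.
move=> iD; rewrite /frag; case: arg_minnP => [|j /andP[_ jW] _].
  by rewrite iD finset.subsetUl.
by rewrite subDset finset.setUC.
Qed.

Lemma frag_disj i : frag i :&: W = finset.set0.
Proof. by rewrite /frag finset.setIDAC finset.setDIl finset.setDv finset.setI0. Qed.

(** The inclusion makes [k] a competitor in the minimisation defining [frag i], while [g k :\: W]
    lies in [frag i]; minimality forces equality. *)
Lemma frag_min i k : i \in D -> k \in D -> g k \subset W :|: frag i -> frag i \subset g k.
Proof.
move=> iD kD gk; suff -> : frag i = g k :\: W by exact: finset.subsetDl.
have kf : g k :\: W \subset frag i by rewrite subDset.
apply/eqP; rewrite eq_sym eqEcard kf /=.
have ki : g k \subset g i :|: W.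
  by apply: fintype.subset_trans gk _; rewrite finset.setUC finset.setSU // frag_sub.
rewrite /frag; case: arg_minnP => [|j _ jmin]; first by rewrite iD finset.subsetUl.
by apply: jmin; rewrite kD ki.
Qed.

End Fragments.

Section Spread.
Variables (R : realType) (X I : finType) (w : I -> R) (q : R).
Hypotheses (w0 : forall i, 0 <= w i) (q0 : 0 < q).
Implicit Types (D : {set I}) (g : I -> {set X}) (W T : {set X}).

(** Indices carry the weights, since fragments of different edges may coincide; the total may drop
    below one as edges are discarded. *)
Definition spread_weight D g :=
  forall S : {set X}, \sum_(i in D | S \subset g i) w i <= q ^+ #|S|.

Definition misses D g W := ~~ [exists i in D, g i \subset W].

(* The miss probability is multiplied by the total weight so that the bound is
   additive over rounds, each of which discards the weight of large fragments. *)
Definition hit_bound (l : nat) (p eps : R) :=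
  forall D g, (forall i, i \in D -> (#|g i| <= l)%N) -> spread_weight D g ->
  Pr (percolation X p) (misses D g) * (\sum_(i in D) w i) <= eps.

Lemma hit_bound0 p : hit_bound 0 p 0.
Proof.
move=> D g gl _; have [->|[i iD]] := set_0Vmem D.
  by rewrite [X in _ * X]big1 ?mulr0 // => i; rewrite finset.in_set0.
rewrite [X in X * _](_ : _ = 0) ?mul0r //; apply: big1 => W /existsP[].
exists i; rewrite iD /=; have := gl i iD; rewrite leqn0 cards_eq0 => /eqP ->.
exact: finset.sub0set.
Qed.

(** There are at most [2 ^ l] subsets, and each term is at most [r ^+ l'.+1] because [r <= 1]. *)
Lemma sum_pow_large (r : R) (l l' : nat) (G : {set X}) :
  0 <= r <= 1 -> (#|G| <= l)%N ->
  \sum_(T : {set X} | (T \subset G) && (l' < #|T|)%N) r ^+ #|T| <= 2 ^+ l * r ^+ l'.+1.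
Proof.
case/andP=> r0 r1 Gl.
apply: (@le_trans _ _ (\sum_(T : {set X} | T \subset G) r ^+ l'.+1)).
  rewrite big_mkcondr /=; apply: ler_sum => T _; case: ifP => [lT|_].
    exact: ler_wiXn2l.
  exact: exprn_ge0.
rewrite sumr_const -[#|_|]/#|[pred T : {set X} | T \subset G]|.
have -> : #|[pred T : {set X} | T \subset G]| = (2 ^ #|G|)%N.
  by rewrite -card_powerset; apply: eq_card => T; rewrite !inE.
rewrite -[leLHS]mulr_natl natrX ler_wpM2r ?exprn_ge0//.
by rewrite ler_weXn2l // ler1n.
Qed.

(** Deleting [T] turns its factors [p] into [1 - p], so the left side is [percolation X p Z] times
    [(1 - p) ^+ #|T|], once the powers of [p] are restored. *)
Lemma percolation_setD (p : R) (Z T : {set X}) : 0 <= p <= 1 -> T \subset Z ->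
  percolation X p (Z :\: T) * p ^+ #|T| <= percolation X p Z.
Proof.
case/andP=> p0 p1 TZ; rewrite !ffunE -prodr_const [X in _ * X]big_mkcond -big_split /=.
apply: ler_prod => x _; rewrite !inE.
have [xT|xT] /= := boolP (x \in T); last first.
  by rewrite mulr1; case: ifP => _; rewrite lexx ?p0 ?subr_ge0 ?p1.
rewrite (fintype.subsetP TZ) //; apply/andP; split; first by rewrite mulr_ge0 ?subr_ge0.
by rewrite ler_piMl // lerBlDr lerDl.
Qed.

(* A large fragment [T] of [W] is recovered from [Z = W :|: T] at the price of
   choosing [T] inside one edge contained in [Z]. *)
Lemma large_fragments (D : {set I}) (g : I -> {set X}) (p del : R) (l l' : nat) :
  0 < p <= 1 -> (forall i, i \in D -> (#|g i| <= l)%N) -> spread_weight D g ->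
  (forall G : {set X}, (#|G| <= l)%N ->
     \sum_(T : {set X} | (T \subset G) && (l' < #|T|)%N) (q / p) ^+ #|T| <= del) ->
  \sum_W percolation X p W * \sum_(i in D | (l' < #|frag X I D g W i|)%N) w i <= del.
Proof.
move=> p01 gl spr Hdel; have [p0 p1] := andP p01.
have p01' : 0 <= p <= 1 by rewrite ltW.
pose U W := [set frag X I D g W i | i in D]%SET.
(* All indices with fragment [T] have [T] inside their edge, so spreadness bounds their weight by
   [q ^+ #|T|]. *)
have step1 W : \sum_(i in D | (l' < #|frag X I D g W i|)%N) w i <=
    \sum_(T : {set X} | (l' < #|T|)%N && (T \in U W)) q ^+ #|T|.
  rewrite (partition_big (frag X I D g W)
    (fun T : {set X} => (l' < #|T|)%N && (T \in U W))) /=; last first.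
    by move=> i /andP[iD ->] /=; apply: imset_f.
  apply: ler_sum => T _; apply: le_trans (spr T).
  rewrite [leLHS]big_mkcond [leRHS]big_mkcond; apply: ler_sum => i _.
  case: ifP => [/andP[/andP[iD _] /eqP <-]|_]; first by rewrite iD frag_sub.
  by case: ifP.
pose Q (Z T : {set X}) := [&& T \subset Z, (l' < #|T|)%N & T \in U (Z :\: T)].
have step2 : \sum_W percolation X p W * \sum_(i in D | (l' < #|frag X I D g W i|)%N) w i <=
    \sum_Z percolation X p Z * \sum_(T | Q Z T) (q / p) ^+ #|T|.
  apply: (@le_trans _ _ (\sum_W \sum_(T : {set X} | (l' < #|T|)%N && (T \in U W))
      percolation X p W * q ^+ #|T|)).
    by apply: ler_sum => W _; rewrite -mulr_sumr ler_wpM2l ?percolation_ge0.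
  under [leRHS]eq_bigr do rewrite mulr_sumr.
  rewrite [leLHS](exchange_big_dep (fun T : {set X} => (l' < #|T|)%N)) /=; last first.
    by move=> W T _ /andP[].
  rewrite [leRHS](exchange_big_dep (fun T : {set X} => (l' < #|T|)%N)) /=; last first.
    by move=> W T _ /and3P[].
  apply: ler_sum => T lT.
  rewrite (reindex_onto (fun Z => Z :\: T) (fun W => W :|: T)) /=; last first.
    move=> W /andP[_ /imsetP[i _ ->]].
    by rewrite finset.setDUl finset.setDv finset.setU0;
      apply/finset.setDidPl; rewrite -setI_eq0 finset.setIC frag_disj.
  rewrite [leLHS]big_mkcond [leRHS]big_mkcond; apply: ler_sum => Z _.
  rewrite /Q lT /=; case: ifP => [/andP[TU /eqP ZT]|_].
    have TZ : T \subset Z by rewrite -ZT finset.subsetUr.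
    rewrite TZ TU /= expr_div_n mulrA ler_pdivlMr ?exprn_gt0// mulrAC.
    by rewrite ler_wpM2r ?percolation_setD// exprn_ge0// ltW.
  by case: ifP => // _; rewrite mulr_ge0 ?percolation_ge0 // exprn_ge0// divr_ge0// ltW.
apply: le_trans step2 _.
rewrite -[leRHS]mul1r -(sum_percolation R X p) // mulr_suml; apply: ler_sum => Z _.
rewrite ler_wpM2l ?percolation_ge0 //.
have r0 : 0 <= q / p by rewrite divr_ge0// ltW.
(* A single pair [(Z, T0)] provides an edge [g j] inside [Z] that does not depend on the summation
   variable [T]. *)
have [T0 /and3P[T0Z _ /imsetP[i0 i0D T0E]]|none] := pickP (Q Z); last first.
  (* [Hdel] at the empty edge gives [0 <= del]. *)
  rewrite big_pred0 //; apply: le_trans (Hdel finset.set0 _); last by rewrite cards0.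
  by apply: sumr_ge0 => T _; rewrite exprn_ge0.
have [j jD jE] := fragE X I D g (Z :\: T0) i0 i0D.
have jZ : g j \subset Z.
  rewrite -(finset.setID (g j) (Z :\: T0)) finset.subUset -jE -T0E T0Z andbT.
  by apply: fintype.subset_trans (finset.subsetIr _ _) (finset.subsetDl _ _).
apply: le_trans (Hdel _ (gl j jD)).
rewrite [leLHS]big_mkcond [leRHS]big_mkcond; apply: ler_sum => T _.
case: ifP => [/and3P[TZ -> /imsetP[i iD TE]]|_]; last by case: ifP => // _; rewrite exprn_ge0.
(* As [g j] lies in [Z], the union of [Z :\: T] and [T], [frag_min] puts every candidate [T] inside
   [g j]. *)
suff -> : T \subset g j by [].
by rewrite {1}TE; apply: frag_min => //; rewrite -TE; apply: fintype.subset_trans jZ _;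
  apply/fintype.subsetP => x xZ; rewrite !inE xZ andbT orNb.
Qed.

(** The first round replaces edges by fragments. Those larger than [l'] are discarded, with average
    weight at most [del], and the second round has to hit the others. *)
Lemma hit_bound_step (l l' : nat) (p1 p2 eps del : R) :
  0 < p1 -> 0 <= p2 -> p1 + p2 <= 1 ->
  (forall G : {set X}, (#|G| <= l)%N ->
     \sum_(T : {set X} | (T \subset G) && (l' < #|T|)%N) (q / p1) ^+ #|T| <= del) ->
  hit_bound l' p2 eps -> hit_bound l (p1 + p2) (eps + del).
Proof.
move=> p10 p20 p12 Hdel IH D g gl spr.
have p11 : p1 <= 1 by apply: le_trans p12; rewrite lerDl.
have p21 : p2 <= 1 by apply: le_trans p12; rewrite lerDr ltW.
have p101 : 0 <= p1 <= 1 by rewrite ltW.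
have p201 : 0 <= p2 <= 1 by rewrite p20.
pose fr W := frag X I D g W.
pose D' W := [set i in D | (#|fr W i| <= l')%N]%SET.
pose bad W := \sum_(i in D | (l' < #|fr W i|)%N) w i.
have M0 : 0 <= \sum_(i in D) w i by apply: sumr_ge0.
have step W1 : (\sum_W2 percolation X p2 W2 * (misses D g (W1 :|: W2))%:R) *
    (\sum_(i in D) w i) <= eps + bad W1.
  apply: (@le_trans _ _ (Pr (percolation X p2) (misses (D' W1) (fr W1)) *
      (\sum_(i in D' W1) w i + bad W1))).
    apply: ler_pM => //.
    - by apply: sumr_ge0 => W _; rewrite mulr_ge0 ?percolation_ge0.
    - rewrite Pr_pred; apply: ler_sum => W2 _; rewrite ler_wpM2l ?percolation_ge0 //.
      rewrite ler_nat; case: (boolP (misses D g _)) => // /existsP H.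
      suff -> : misses (D' W1) (fr W1) W2 by [].
      apply/existsP => -[i /andP[]]; rewrite inE => /andP[iD _] iW2; apply: H.
      have [j jD jE] := fragE X I D g W1 i iD.
      by exists j; rewrite jD /= -subDset -jE.
    - rewrite (bigID (fun i => (#|fr W1 i| <= l')%N)) /=; apply: lerD.
        by rewrite le_eqVlt; apply/orP; left; apply/eqP/eq_bigl => i; rewrite inE.
      by rewrite le_eqVlt; apply/orP; left; apply/eqP/eq_bigl => i; rewrite ltnNge.
  have b0 : 0 <= bad W1 by apply: sumr_ge0.
  rewrite mulrDr; apply: lerD; last first.
    by rewrite ler_piMl // Pr_le1 //; apply: percolation_pmf.
  (* Fragments lie inside their edges, so they inherit spreadness. *)
  apply: IH => [i|S]; first by rewrite inE => /andP[].
  apply: le_trans (spr S); rewrite [leLHS]big_mkcond [leRHS]big_mkcond.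
  apply: ler_sum => i _; rewrite inE; case: ifP => [/andP[/andP[iD _] Si]|_]; last by case: ifP.
  by rewrite iD (fintype.subset_trans Si) // frag_sub.
rewrite Pr_pred.
apply: le_trans (ler_wpM2r M0 (percolation_union R X p1 p2 _ (ltW p10) p20 p12 _)) _.
  move=> A B AB; rewrite ler_nat; case: (boolP (misses D g B)) => // /existsP H.
  suff -> : misses D g A by [].
  by apply/existsP => -[i /andP[iD iA]]; apply: H; exists i; rewrite iD (fintype.subset_trans iA).
rewrite mulr_suml.
apply: (@le_trans _ _ (\sum_W percolation X p1 W * (eps + bad W))).
  by apply: ler_sum => W _; rewrite -mulrA ler_wpM2l ?percolation_ge0.
under eq_bigr do rewrite mulrDr.
rewrite big_split -mulr_suml sum_percolation // mul1r lerD2l.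
by apply: large_fragments Hdel => //; rewrite p10.
Qed.

(** [k] rounds of density [8 * q] halve the size bound from [m * 2 ^ k] down to [m]; a round of
    density [M * q] then leaves only empty fragments, up to weight [2 ^+ m / M]. *)
Lemma hit_bound_iter (m k : nat) (M p : R) :
  (0 < m)%N -> 1 <= M -> (M + 8 * k%:R) * q <= p -> p <= 1 ->
  hit_bound (m * 2 ^ k) p (2 ^+ m / M + 2 / 2 ^+ m - 2 / 2 ^+ (m + k)).
Proof.
move=> m0 M1 + p1; elim: k p p1 => [|k IH] p p1 Hp.
  rewrite expn0 muln1 addn0 addrK -[X in hit_bound _ _ X]add0r.
  rewrite mulr0 addr0 in Hp.
  have M0 : 0 < M by apply: lt_le_trans M1.
  (* Here [l' = 0], so every nonempty fragment is discarded; the surplus density goes to the trivial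
     [hit_bound0]. *)
  have -> : p = M * q + (p - M * q) by ring.
  apply: hit_bound_step (hit_bound0 _); rewrite ?subr_ge0 ?mulr_gt0 //; first by lra.
  have -> : q / (M * q) = M^-1 by field; rewrite !gt_eqF.
  move=> G Gm; rewrite -[M^-1]expr1; apply: sum_pow_large => //.
  by rewrite expr1 invr_ge0 ltW //= invf_le1.
have -> : p = 8 * q + (p - 8 * q) by ring.
have k0 : 0 <= M + 8 * k%:R by rewrite addr_ge0 // (le_trans _ M1).
rewrite -(natr1 k) in Hp.
have kq := mulr_ge0 k0 (ltW q0).
(* The errors telescope: this round may cost [2 / 2 ^+ (m + k) - 2 / 2 ^+ (m + k.+1)]. *)
have -> : 2 ^+ m / M + 2 / 2 ^+ m - 2 / 2 ^+ (m + k.+1) =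
  (2 ^+ m / M + 2 / 2 ^+ m - 2 / 2 ^+ (m + k)) + (1 / 2 ^+ (m + k) : R).
  have : (2 : R) ^+ (m + k) != 0 by rewrite expf_neq0.
  by rewrite addnS exprS; move: (2 ^+ m / M + _) (2 ^+ (m + k)) => a b b0; field.
apply: (hit_bound_step _ (m * 2 ^ k)).
- by rewrite mulr_gt0.
- move: kq Hp q0; lra.
- by lra.
- have -> : q / (8 * q) = 8^-1 by field; rewrite gt_eqF.
  move=> G Gm; apply: (le_trans (sum_pow_large 8^-1 _ (m * 2 ^ k) _ _ Gm)).
    by apply/andP; split; lra.
  (* Going from size [2 * l] to [l] costs [4 ^+ l / 8 ^+ l.+1], that is [2 ^- l / 8]. *)
  rewrite [8^-1 ^+ _]exprSr expnSr mulnA mulnC exprM.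
  set l := (m * 2 ^ k)%N.
  have ml : (m + k <= l)%N.
    have := ltn_expl k (leqnn 2); rewrite /l; nia.
  have -> : (2 ^+ 2) ^+ l * ((8^-1) ^+ l * 8^-1) = 8^-1 * (2^-1) ^+ l :> R.
    rewrite mulrA -exprMn mulrC; congr (_ * _ ^+ _); by field.
  apply: (@le_trans _ _ (1 * (2^-1 : R) ^+ (m + k))); last by rewrite exprVn.
  by apply: ler_pM; [lra|apply: exprn_ge0; lra|lra|apply: ler_wiXn2l => //; lra].
- by apply: IH; move: q0; lra.
Qed.

End Spread.

(** * From lists of colours to one colour *)

Section Coupling.
Variables (R : realType) (Omega : finType) (h : nat).
Notation C := 'I_h.

(* The two hypotheses say that [E] reads at most one colour per vertex. If [G] is
   the set of colours of a vertex that make [E] true, a random list meets [G] with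
   probability at most [#|G| * (rho / h)], with equality for a single colour. *)
Lemma coloured_percolation_dom (rho : R) (E : {ffun Omega -> {set C}} -> bool) :
  (0 < h)%N -> 0 <= rho <= 1 ->
  (forall f x L, E (upd Omega _ f x finset.set0) -> E (upd Omega _ f x L)) ->
  (forall f x L, E (upd Omega _ f x L) -> E (upd Omega _ f x finset.set0) \/
     exists2 c, c \in L & E (upd Omega _ f x [set c]%SET)) ->
  Pr (percolation (Omega * C)%type (rho / h%:R))
     (fun W => E [ffun x => [set c | (x, c) \in W]%SET]) <=
  Pr (prod_pmf (uniform_colouring R Omega h) (percolation Omega rho))
     (fun z => E [ffun x => if x \in z.2 then [set z.1 x]%SET else finset.set0]).
Proof.
move=> h0 /andP[rho0 rho1] Emono Epick.
have hR0 : 0 < h%:R :> R by rewrite ltr0n.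
have p01 : 0 <= rho / h%:R <= 1.
  rewrite divr_ge0 //= ler_pdivrMr // mul1r (le_trans rho1) // ler1n //.
pose phi (f : {ffun Omega -> {set C}}) : R := (E f)%:R.
have -> : Pr (percolation (Omega * C)%type (rho / h%:R))
     (fun W => E [ffun x => [set c | (x, c) \in W]%SET]) =
   prodE R Omega _ (fun=> percolation C (rho / h%:R)) phi.
  rewrite Pr_pred /prodE.
  rewrite (reindex (fun f : {ffun Omega -> {set C}} => [set z | z.2 \in f z.1]%SET)) /=.
    apply: eq_bigr => f _; congr (_ * _); last first.
      by congr (_%:R); congr (nat_of_bool (E _)); apply/ffunP => x;
        rewrite ffunE; apply/setP => c; rewrite !inE.
    under [RHS]eq_bigr do rewrite ffunE.
    by rewrite ffunE pair_bigA; apply: eq_bigr => -[x c] _; rewrite inE.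
  exists (fun W : {set Omega * C} => [ffun x => [set c | (x, c) \in W]%SET]) => [f _|W _].
    by apply/ffunP => x; rewrite ffunE; apply/setP => c; rewrite !inE.
  by apply/setP => -[x c]; rewrite !inE ffunE inE.
(* A coordinate carries a uniform colour and a bit telling whether the vertex is kept; [pi] reads it
   as a list of at most one colour. *)
pose m (x : Omega) (v : C * bool) : R := h%:R^-1 * bern R rho v.2.
pose pi (v : C * bool) : {set C} := if v.2 then [set v.1]%SET else finset.set0.
have -> : Pr (prod_pmf (uniform_colouring R Omega h) (percolation Omega rho))
     (fun z => E [ffun x => if x \in z.2 then [set z.1 x]%SET else finset.set0]) =
   prodE R Omega _ m (fun f => phi [ffun x => pi (f x)]).
  rewrite Pr_pred /prodE.
  rewrite (reindex (fun f : {ffun Omega -> C * bool} =>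
     ([ffun x => (f x).1], [set x | (f x).2]%SET))) /=.
    apply: eq_bigr => f _; rewrite !ffunE -big_split /=; congr (_ * _).
      by apply: eq_bigr => x _; rewrite inE.
    by congr (_%:R); congr (nat_of_bool (E _)); apply/ffunP => x; rewrite !ffunE inE.
  exists (fun z : {ffun Omega -> C} * {set Omega} => [ffun x => (z.1 x, x \in z.2)])
    => [f _|[c W] _].
    by apply/ffunP => x; rewrite !ffunE inE; case: (f x).
  by congr pair; [apply/ffunP|apply/setP] => x; rewrite ?ffunE ?inE ?ffunE.
have m0 x v : 0 <= m x v.
  by rewrite mulr_ge0 ?invr_ge0 // /bern; case: ifP; rewrite ?subr_ge0.
have m1 x : \sum_v m x v = 1.
  rewrite -(pair_bigA _ (fun c b => h%:R^-1 * bern R rho b)) /=.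
  under eq_bigr do rewrite big_bool /= /bern -mulrDr addrC subrK mulr1.
  by rewrite sumr_const card_ord -[LHS]mulr_natr mulVf // gt_eqF.
rewrite prodE_push; apply: prodE_dom => [x L|x L|x|x f].
- exact: percolation_ge0.
- exact: sumr_ge0.
- by rewrite -(m1 x) (partition_big pi predT).
have -> : \sum_L (\sum_(v | pi v == L) m x v) * phi (upd Omega _ f x L) =
    \sum_v m x v * phi (upd Omega _ f x (pi v)).
  rewrite [RHS](partition_big pi predT) //=; apply: eq_bigr => L _.
  by rewrite mulr_suml; apply: eq_bigr => v /eqP <-.
have [Ef0|nEf0] := boolP (E (upd Omega _ f x finset.set0)).
  have phi1 L : phi (upd Omega _ f x L) = 1 by rewrite /phi Emono.
  under eq_bigr do rewrite phi1 mulr1.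
  under [leRHS]eq_bigr do rewrite phi1 mulr1.
  by rewrite sum_percolation // m1.
(* The empty list now fails, so a union bound over the colours of the list applies, each being
   present with probability [rho / h%:R]. *)
apply: (@le_trans _ _ (\sum_c rho / h%:R * phi (upd Omega _ f x [set c]%SET))).
  have -> : \sum_c rho / h%:R * phi (upd Omega _ f x [set c]%SET) =
      \sum_(c : C) \sum_L percolation C (rho / h%:R) L * ([set c]%SET \subset L)%:R *
        phi (upd Omega _ f x [set c]%SET).
    apply: eq_bigr => c _.
    by rewrite -mulr_suml -(Pr_pred _ _ _ (fun L : {set C} => [set c]%SET \subset L))
      Pr_percolation_sup cards1.
  rewrite exchange_big /=; apply: ler_sum => L _.
  under eq_bigr do rewrite -mulrA.
  rewrite -mulr_sumr ler_wpM2l ?percolation_ge0 // {1}/phi.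
  have [EL|_] := boolP (E (upd Omega _ f x L)); last first.
    by apply: sumr_ge0 => c _; rewrite mulr_ge0.
  have [Ef0|[c cL Ec]] := Epick _ _ _ EL; first by rewrite Ef0 in nEf0.
  rewrite (bigD1 c) //= /phi Ec finset.sub1set cL mulr1 lerDl.
  by apply: sumr_ge0 => c' _; rewrite mulr_ge0.
have -> : \sum_v m x v * phi (upd Omega _ f x (pi v)) =
    \sum_c \sum_b m x (c, b) * phi (upd Omega _ f x (pi (c, b))).
  by rewrite pair_bigA; apply: eq_bigr => -[].
apply: ler_sum => c _; rewrite big_bool /= /m /pi /= mulrC [rho / _]mulrC mulrC lerDl.
by rewrite mulr_ge0 // mulr_ge0 ?invr_ge0 // /bern subr_ge0.
Qed.

End Coupling.

(** * Graphs of random bijections *)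

(** Composing with the inverse of one such permutation [s0] injects them all into the permutations
    that fix [Y] pointwise. *)
Lemma card_perm_prescribed (T : finType) (Y : {set T}) (z : T -> T) :
  (#|[set s : {perm T} | [forall y in Y, s y == z y]]%SET| <= (#|T| - #|Y|)`!)%N.
Proof.
set A := [set _ | _]%SET; have [->|[s0 s0A]] := set_0Vmem A; first by rewrite cards0.
have fixA s y : s \in A -> y \in Y -> s y = z y.
  by rewrite inE => /forallP/(_ y) /implyP H yY; apply/eqP/H.
have -> : (#|T| - #|Y|)%N = #|~: Y| by rewrite [RHS]cardsCs finset.setCK.
rewrite -card_perm -(card_imset _ (@mulIg _ (s0^-1)%g)).
apply/subset_leq_card/fintype.subsetP => _ /imsetP[s sA ->].
rewrite unfold_in; apply/fintype.subsetP => y; rewrite !inE; apply: contra => yY.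
by rewrite permM (fixA _ _ sA yY) -(fixA _ _ s0A yY) permK.
Qed.

(** By induction: raising the denominator from [n.+1] to [n.+2] in [s] factors costs at most
    [(1 + 1 / n.+1) ^ s <= e], paid by the new factor [e]. *)
Lemma fact_ratio_le (R : realType) (n s : nat) : (s <= n.+1)%N ->
  (n.+1 - s)`!%:R / (n.+1)`!%:R <= (expR 1 / n.+1%:R) ^+ s :> R.
Proof.
elim: n s => [|n IH] [|s] sn; try by rewrite subn0 expr0 divff // pnatr_eq0 -lt0n fact_gt0.
  have -> : s = 0%N by lia.
  by rewrite subnn expr1 !divr1 ltW // expR_gt1.
rewrite subSS factS natrM invfM mulrCA.
apply: (@le_trans _ _ (n.+2%:R^-1 * (expR 1 / n.+1%:R) ^+ s)).
  by rewrite ler_wpM2l ?invr_ge0 ?IH.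
have n1 : 0 < n.+1%:R :> R by rewrite ltr0n.
have n2 : 0 < n.+2%:R :> R by rewrite ltr0n.
have -> : expR 1 / n.+1%:R = (expR 1 / n.+2%:R) * (n.+2%:R / n.+1%:R) :> R.
  by field; rewrite !gt_eqF.
have H : (n.+2%:R / n.+1%:R) ^+ s <= expR 1 :> R.
  have -> : n.+2%:R / n.+1%:R = 1 + n.+1%:R^-1 :> R.
    by rewrite -[n.+2%:R]natr1 mulrDl divff ?gt_eqF// mul1r.
  apply: (@le_trans _ _ (expR n.+1%:R^-1 ^+ s)).
    by rewrite lerXn2r ?nnegrE ?expR_ge0 ?expR_ge1Dx ?addr_ge0 ?invr_ge0 ?ltW.
  rewrite -expRM_natl ler_expR ler_pdivrMr // mul1r ler_nat.
  by lia.
rewrite exprMn exprS mulrCA [leRHS]mulrC ler_wpM2l ?exprn_ge0 ?divr_ge0 ?expR_ge0 //.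
by rewrite mulrC ler_wpM2r ?invr_ge0.
Qed.

Section Rainbow.
Variables (R : realType) (Omega : finType) (n : nat).
Notation C := 'I_n.+1.

(** A numbering of [A] by colours, which turns a permutation of the palette into a bijection from
    [A] when [#|A| = n.+1]. *)
Definition position (A : {set Omega}) (x : Omega) : C := inord (index x (enum A)).

Lemma position_inj (A : {set Omega}) : #|A| = n.+1 -> {in A &, injective (position A)}.
Proof.
move=> cA x y xA yA /(congr1 val); rewrite /= !inordK; last 2 first.
- by rewrite -cA cardE index_mem mem_enum.
- by rewrite -cA cardE index_mem mem_enum.
by move=> eq_i; rewrite -(nth_index x (s := enum A) (x := x)) ?mem_enum // eq_i nth_index ?mem_enum.
Qed.

Definition rainbow_copy (i : {set Omega} * {perm C}) : {set Omega * C} :=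
  [set (x, i.2 (position i.1 x)) | x in i.1]%SET.

(** If [S] lies in some graph over [A], its first coordinates are distinct elements of [A], and it
    prescribes the permutation at [#|S|] positions. *)
Lemma card_perm_rainbow_copy (A : {set Omega}) (S : {set Omega * C}) :
  #|A| = n.+1 ->
  (\sum_(s : {perm C} | S \subset rainbow_copy (A, s)) 1 : R) / (n.+1)`!%:R <=
  ((#|[set z.1 | z in S]%SET| == #|S|) && ([set z.1 | z in S]%SET \subset A))%:R *
    (expR 1 / n.+1%:R) ^+ #|S|.
Proof.
move=> cA; set S1 := [set _ | _ in _]%SET.
have e0 : 0 <= (expR 1 / n.+1%:R) ^+ #|S| :> R by rewrite exprn_ge0 // divr_ge0 // expR_ge0.
have [s0 s0S|none] := pickP (fun s : {perm C} => S \subset rainbow_copy (A, s)); last first.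
  by rewrite big_pred0 // mul0r mulr_ge0.
have inS z s : S \subset rainbow_copy (A, s) -> z \in S ->
    z.1 \in A /\ z.2 = s (position A z.1).
  by move=> /fintype.subsetP H /H /imsetP[x xA ->].
have S1A : S1 \subset A.
  by apply/fintype.subsetP => _ /imsetP[z zS ->]; case: (inS _ _ s0S zS).
have cS1 : #|S1| = #|S|.
  apply: card_in_imset => -[x c] [y d] /(inS _ _ s0S)[_ /= ->] /(inS _ _ s0S)[_ /= ->].
  by move=> ->.
rewrite cS1 eqxx S1A mul1r.
pose Y := [set position A x | x in S1]%SET.
have cY : #|Y| = #|S|.
  rewrite -cS1; apply: card_in_imset => x y xS yS.
  by apply: position_inj => //; apply: (fintype.subsetP S1A).
have Sn : (#|S| <= n.+1)%N by rewrite -cY (leq_trans (max_card _)) ?card_ord.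
apply: le_trans (fact_ratio_le R n #|S| Sn).
rewrite ler_wpM2r ?invr_ge0 // sumr_const ler_nat.
have := card_perm_prescribed C Y s0; rewrite card_ord cY; apply: leq_trans.
apply/subset_leq_card/fintype.subsetP => s; rewrite unfold_in inE => sS.
apply/forallP => y; apply/implyP => /imsetP[x /imsetP[z zS ->] ->].
by have [_ <-] := inS _ _ sS zS; have [_ <-] := inS _ _ s0S zS.
Qed.

Lemma contains_rainbow_lower (F : {set {set Omega}}) (mu : {ffun {set Omega} -> R})
    (q rho M : R) (m k : nat) :
  (forall A, A \in F -> #|A| = n.+1) ->
  is_pmf mu -> Pr mu (fun A => A \in F) = 1 -> spread q mu -> 0 < q ->
  0 <= rho <= 1 -> (0 < m)%N -> 1 <= M -> (n.+1 <= m * 2 ^ k)%N ->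
  (M + 8 * k%:R) * (expR 1 * q) <= rho ->
  1 - (2 ^+ m / M + 2 / 2 ^+ m) <=
  Pr (prod_pmf (uniform_colouring R Omega n.+1) (percolation Omega rho))
     (fun z => contains_rainbow F z.1 z.2).
Proof.
move=> cF [mu0 mu1] muF spr q0 rho01 m0 M1 nmk Hrho.
have h0 : 0 < n.+1%:R :> R by rewrite ltr0n.
pose w (i : {set Omega} * {perm C}) : R := mu i.1 / (n.+1)`!%:R.
have w0 i : 0 <= w i by rewrite divr_ge0.
pose D := [set i : {set Omega} * {perm C} | i.1 \in F]%SET.
pose q' := expR 1 * q / n.+1%:R.
have q'0 : 0 < q' by rewrite divr_gt0 // mulr_gt0 // expR_gt0.
have sumD (Q : {set Omega} -> pred {perm C}) :
    \sum_(i in D | Q i.1 i.2) w i =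
    \sum_(A in F) mu A * ((\sum_(s | Q A s) 1) / (n.+1)`!%:R).
  transitivity (\sum_(i | (i.1 \in F) && Q i.1 i.2) mu i.1 * (n.+1)`!%:R^-1 * 1).
    by apply: eq_big => [i|i _]; rewrite ?inE // mulr1.
  rewrite -(pair_big_dep (fun A => A \in F) Q (fun A s => mu A * (n.+1)`!%:R^-1 * 1)) /=.
  by apply: eq_bigr => A _; rewrite -mulr_sumr mulrAC mulrA.
have wD : \sum_(i in D) w i = 1.
  rewrite -muF /Pr; transitivity (\sum_(i in D | xpredT i.2) w i).
    by apply: eq_bigl => i; rewrite andbT.
  rewrite (sumD (fun=> xpredT)); apply: eq_bigr => A _.
  have -> : \sum_(s : {perm C}) 1 = (n.+1)`!%:R :> R by rewrite sumr_const card_Sn.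
  by rewrite divff ?mulr1 // pnatr_eq0 -lt0n fact_gt0.
have sprD : spread_weight R _ _ w q' D rainbow_copy.
  move=> S; rewrite (sumD (fun A s => S \subset rainbow_copy (A, s))).
  set S1 := [set z.1 | z in S]%SET.
  apply: (@le_trans _ _ (\sum_(A in F) mu A *
      (((#|S1| == #|S|) && (S1 \subset A))%:R * (expR 1 / n.+1%:R) ^+ #|S|))).
    by apply: ler_sum => A AF; rewrite ler_wpM2l // card_perm_rainbow_copy // cF.
  have [cS1|_] := eqVneq #|S1| #|S|; last first.
    by rewrite big1 ?exprn_ge0 1?ltW // => A _; rewrite mul0r mulr0.
  (* The permutation gives [(e / n.+1) ^ #|S|], and spreadness of [mu] at [S1] gives [q ^ #|S1|]
     with [#|S1| = #|S|]. *)
  rewrite /q' [expR 1 * q]mulrC -mulrA [leRHS]exprMn -{2}cS1.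
  under eq_bigr do rewrite mulrA.
  rewrite -mulr_suml ler_wpM2r ?exprn_ge0 ?divr_ge0 ?expR_ge0 //.
  apply: le_trans (spr S1); rewrite /Pr [leLHS]big_mkcond [leRHS]big_mkcond.
  apply: ler_sum => A _; case: ifP => _; case: ifP => _; rewrite ?mulr1 ?mulr0 //.
have h1 : 1 <= n.+1%:R :> R by rewrite ler1n.
have rho1 : rho / n.+1%:R <= 1.
  by rewrite ler_pdivrMr // mul1r (le_trans _ h1) //; case/andP: rho01.
have := hit_bound_iter R (Omega * C)%type _ w q' w0 q'0 m k M (rho / n.+1%:R) m0 M1 _ rho1.
have -> : (M + 8 * k%:R) * q' <= rho / n.+1%:R by rewrite mulrA ler_wpM2r ?invr_ge0.
move=> /(_ isT D rainbow_copy _ sprD); rewrite wD mulr1 => hit.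
have {}hit : Pr (percolation (Omega * C)%type (rho / n.+1%:R))
    (misses (Omega * C)%type _ D rainbow_copy) <= 2 ^+ m / M + 2 / 2 ^+ m.
  apply: le_trans (hit _) _ => [i|].
    rewrite inE => iF; apply: leq_trans nmk; apply: leq_trans (leq_imset_card _ _) _.
    by rewrite (cF _ iF).
  by rewrite gerBl divr_ge0 // exprn_ge0.
(* [E] asks for a member with a rainbow choice from the lists, so it reads one colour per vertex of
   that member. *)
pose E (f : {ffun Omega -> {set C}}) := [exists A in F, [exists c : {ffun Omega -> C},
  rainbow c A && [forall x in A, c x \in f x]]].
have p01 : 0 <= rho / n.+1%:R <= 1.
  by rewrite rho1 divr_ge0 //; case/andP: rho01.
apply: (@le_trans _ _ (Pr (percolation (Omega * C)%type (rho / n.+1%:R))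
     (fun W => E [ffun x => [set c | (x, c) \in W]%SET]))).
  rewrite lerBlDr; apply: le_trans (lerD (lexx _) hit).
  rewrite -[leLHS](sum_percolation R (Omega * C)%type _ p01).
  rewrite (bigID (fun W : {set Omega * C} => E [ffun x => [set c | (x, c) \in W]%SET])) /=.
  rewrite lerD2l; apply: Pr_le => W; first exact: percolation_ge0.
  apply: contra => /existsP[[A s] /andP[]]; rewrite inE /= => AF AW.
  apply/existsP; exists A; rewrite AF /=; apply/existsP; exists [ffun x => s (position A x)].
  apply/andP; split.
    apply/dinjectiveP => x y xA yA; rewrite !ffunE => /perm_inj.
    by apply: position_inj => //; apply: cF.
  apply/forallP => x; apply/implyP => xA; rewrite !ffunE inE.
  by apply: (fintype.subsetP AW); apply/imsetP; exists x.
apply: le_trans (coloured_percolation_dom R Omega _ rho E _ rho01 _ _) _ => //.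
- move=> f x L /existsP[A /andP[AF /existsP[c /andP[cA /forallP H]]]].
  apply/existsP; exists A; rewrite AF /=; apply/existsP; exists c; rewrite cA /=.
  apply/forallP => y; apply/implyP => yA; have := H y; rewrite yA /= /upd !ffunE.
  by case: eqP => // _; rewrite inE.
- move=> f x L /existsP[A /andP[AF /existsP[c /andP[cA /forallP H]]]].
  have [xA|xA] := boolP (x \in A); [right; exists (c x)|left].
  + by have := H x; rewrite xA /= /upd ffunE eqxx.
  + apply/existsP; exists A; rewrite AF /=; apply/existsP; exists c; rewrite cA /=.
    apply/forallP => y; apply/implyP => yA; have := H y; rewrite yA /= /upd !ffunE.
    by case: eqP => // ->; rewrite inE.
  + apply/existsP; exists A; rewrite AF /=; apply/existsP; exists c; rewrite cA /=.
    apply/forallP => y; apply/implyP => yA; have := H y; rewrite yA /= /upd !ffunE.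
    by case: eqP => // yx; rewrite -yx yA in xA.
apply: Pr_le => [z|[c W] /= /existsP[A /andP[AF /existsP[d /andP[dA /forallP H]]]]].
  by have [] := prod_pmf_pmf (uniform_colouring_pmf R Omega (ltn0Sn n))
    (percolation_pmf Omega rho01).
(* Lists now have at most one colour, so the choice [d] agrees with the colouring on [A] and forces
   [A] into [W]. *)
have cd x : x \in A -> x \in W /\ d x = c x.
  by move=> xA; have := H x; rewrite xA ffunE /=; case: ifP; rewrite inE // => _ /eqP.
apply/existsP; exists A; rewrite AF /=; apply/andP; split.
  by apply/fintype.subsetP => x /cd[].
apply/dinjectiveP => x y xA yA; have [[_ <-] [_ <-]] := (cd x xA, cd y yA).
by move/dinjectiveP: dA; apply.
Qed.

End Rainbow.

(** * The spread measure from conditioned percolation *)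

Lemma supports_spread_percolation (R : realType) (Omega : finType) (F : {set {set Omega}})
    (theta : R) :
  let a := Pr (percolation Omega theta) (contains_member F) in
  0 < theta <= 1 -> 0 < a -> supports_spread F (theta / a).
Proof.
move=> a /andP[t0 t1] a0.
have t01 : 0 <= theta <= 1 by rewrite ltW.
have P0 W : 0 <= percolation Omega theta W by exact: percolation_ge0.
pose sel (W : {set Omega}) : {set Omega} := odflt finset.set0 [pick A in F | A \subset W].
have selP W : contains_member F W -> sel W \in F /\ sel W \subset W.
  by rewrite /sel; case: pickP => [A /andP[]//|none] /existsP[A]; rewrite none.
pose mu : {ffun {set Omega} -> R} :=
  [ffun A => (\sum_(W | contains_member F W && (sel W == A)) percolation Omega theta W) / a].
have muE (P : pred {set Omega}) :
    Pr mu P = (\sum_(W | contains_member F W && P (sel W)) percolation Omega theta W) / a.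
  rewrite (partition_big sel P) /=; last by move=> W /andP[].
  rewrite mulr_suml; apply: eq_bigr => A PA; rewrite ffunE; congr (_ / _).
  by apply: eq_bigl => W; case: eqP => [->|]; rewrite ?PA ?andbT ?andbF.
have mu1 : \sum_A mu A = 1.
  rewrite -[LHS]/(Pr mu predT) muE (eq_bigl (contains_member F)) ?divff ?gt_eqF // => W.
  by rewrite andbT.
have mu_pmf : is_pmf mu by split=> // A; rewrite ffunE divr_ge0 ?sumr_ge0 // ltW.
exists mu; split=> //.
- rewrite muE (eq_bigl (contains_member F)) ?divff ?gt_eqF // => W.
  by case: (boolP (contains_member F W)) => // /selP[].
(* Conditioning gives [theta ^+ #|S| / a]. As [a <= 1], this is at most [(theta / a) ^+ #|S|] only
   through [#|S| >= 1], so the empty set is treated apart. *)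
move=> S; have [->|/set0Pn[x xS]] := eqVneq S finset.set0.
  by rewrite cards0 expr0; apply: Pr_le1.
have a1 : a <= 1.
  by apply: Pr_le1; apply: percolation_pmf.
rewrite muE; apply: (@le_trans _ _ (theta ^+ #|S| / a)).
  rewrite ler_wpM2r ?invr_ge0 ?(ltW a0) // -Pr_percolation_sup.
  rewrite /Pr [leLHS]big_mkcond [leRHS]big_mkcond.
  apply: ler_sum => W _; case: ifP => [/andP[/selP[_ sW] Ss]|_]; last by case: ifP.
  by rewrite (fintype.subset_trans Ss).
have S0 : (0 < #|S|)%N by apply/card_gt0P; exists x.
rewrite expr_div_n ler_wpM2l ?exprn_ge0 ?(ltW t0) //.
rewrite lef_pV2 ?posrE ?exprn_gt0 // -[leRHS]expr1 ler_wiXn2l ?(ltW a0) //.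
Qed.

(** * Choice of the parameters *)

Lemma ln2_ge (R : realType) : 1 / 2 <= ln (2 : R).
Proof.
have := @le_ln1Dx R (- (1 / 2)).
have -> : 1 + - (1 / 2) = 2^-1 :> R by field.
rewrite lnV ?posrE //; lra.
Qed.

(** [m] and [M] depend on [eps] alone, each making one error term at most [eps / 2]; only [k], about
    the binary logarithm of [h], grows. *)
Lemma round_parameters (R : realType) (eps : R) : 0 < eps ->
  exists H : nat, (0 < H)%N /\ forall h : nat, (H <= h)%N ->
  exists m k : nat, exists M : R,
    [/\ (0 < m)%N, 1 <= M, (h <= m * 2 ^ k)%N, 2 ^+ m / M + 2 / 2 ^+ m <= eps &
        M + 8 * k%:R <= 20 * ln h%:R].
Proof.
move=> e0.
have e40 : 0 <= 4 / eps by rewrite divr_ge0 // ltW.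
pose m := Num.bound (4 / eps).
have mP : 4 / eps < m%:R by exact: archi_boundP.
have m0 : (0 < m)%N by rewrite -(ltr0n R); apply: le_lt_trans mP.
have m2 : 4 / eps <= 2 ^+ m.
  by rewrite ltW // (lt_trans mP) // -natrX ltr_nat ltn_expl.
have p0 : 0 < 2 ^+ m :> R by rewrite exprn_gt0.
pose M : R := 2 ^+ m * (2 / eps) + 1.
have Mm0 : 0 <= 2 ^+ m * (2 / eps) by rewrite mulr_ge0 ?divr_ge0 // ltW.
have M1 : 1 <= M by rewrite lerDr.
pose H := Num.bound (expR (8 + M)).
have HP : expR (8 + M) < H%:R by apply: archi_boundP; exact: expR_ge0.
have H0 : (0 < H)%N by rewrite -(ltr0n R); apply: le_lt_trans HP; exact: expR_ge0.
exists H; split=> // h Hh.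
have h0 : (0 < h)%N by apply: leq_trans Hh.
exists m, (trunc_log 2 h).+1, M; split=> //.
- apply: (@leq_trans (2 ^ (trunc_log 2 h).+1)); first by rewrite ltnW // trunc_log_ltn.
  by rewrite leq_pmull.
- have M0 : 0 < M by apply: lt_le_trans M1.
  have A1 : 2 ^+ m / M <= eps / 2.
    rewrite ler_pdivrMr // /M mulrDr.
    have -> : eps / 2 * (2 ^+ m * (2 / eps)) = 2 ^+ m by field; rewrite gt_eqF.
    by lra.
  have A2 : 2 / 2 ^+ m <= eps / 2.
    rewrite ler_pdivrMr //; apply: le_trans (ler_wpM2l _ m2); last by lra.
    have -> : eps / 2 * (4 / eps) = 2 by field; rewrite gt_eqF.
    by [].
  by lra.
have lnh : 8 + M <= ln h%:R.
  rewrite -[leLHS]expRK ler_ln ?posrE ?expR_gt0 ?ltr0n //.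
  by rewrite ltW // (lt_le_trans HP) // ler_nat.
have : (trunc_log 2 h)%:R * ln 2 <= ln h%:R :> R.
  rewrite mulr_natl -lnXn // ler_ln ?posrE ?exprn_gt0 ?ltr0n // -natrX ler_nat.
  exact: trunc_logP.
have t0 : 0 <= (trunc_log 2 h)%:R :> R by [].
(* [8 + M] is at most [ln h], and eight times the binary logarithm is at most [16 * ln h]. *)
rewrite -natr1; have := ln2_ge R; nra.
Qed.

(** [H] depends on [eps] alone, which makes the bound uniform over the sequence. The constant is
    [20] from the rounds times [e] from the random bijection. *)
Lemma rainbow_whp (R : realType) (eps : R) : 0 < eps ->
  exists H : nat, forall (h : nat) (Omega : finType) (F : {set {set Omega}}) (q rho : R),
  (H <= h)%N -> (forall A, A \in F -> #|A| = h) -> supports_spread F q -> 0 < q ->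
  0 <= rho <= 1 -> 2 * (10 * expR 1) * q * ln h%:R <= rho ->
  1 - eps <= Pr (prod_pmf (uniform_colouring R Omega h) (percolation Omega rho))
     (fun z => contains_rainbow F z.1 z.2).
Proof.
move=> /round_parameters[H [H0 HP]]; exists H => h Omega F q rho Hh.
have [m [k [M [m0 M1 hmk epsP lnP]]]] := HP h Hh.
case: h Hh hmk lnP => [|n] Hn hmk lnP cF [mu [mu01 muF spr]] q0 rho01 Hrho.
  by rewrite leqNgt H0 in Hn.
apply: (@le_trans _ _ (1 - (2 ^+ m / M + 2 / 2 ^+ m))); first by rewrite lerB.
apply: (contains_rainbow_lower R Omega n F mu q rho M m k) => //.
apply: le_trans Hrho; have eq0 : 0 <= expR 1 * q by rewrite mulr_ge0 ?expR_ge0 ?(ltW q0).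
apply: le_trans (ler_wpM2r eq0 lnP) _; lra.
Qed.

Lemma Pr_prod_fst (R : realType) (T U : finType) (mu : {ffun T -> R}) (nu : {ffun U -> R})
    (E : pred T) : is_pmf nu -> Pr (prod_pmf mu nu) (fun z => E z.1) = Pr mu E.
Proof.
case=> _ nu1; rewrite /Pr; transitivity (\sum_(z | E z.1 && true) mu z.1 * nu z.2).
  by apply: eq_big => [z|z _]; rewrite ?andbT ?ffunE.
rewrite -(pair_big_dep E (fun _ _ => true) (fun x y => mu x * nu y)) /=.
by apply: eq_bigr => x _; rewrite -mulr_sumr nu1 mulr1.
Qed.

(** * Passage to the limit *)

Local Open Scope classical_set_scope.
Local Open Scope ring_scope.

Lemma cvg_Pr1 (R : realType) (f : nat -> R) :
  (forall eps : R, 0 < eps -> \forall n \near \oo, 1 - eps <= f n <= 1) ->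
  f n @[n --> \oo] --> (1 : R).
Proof.
move=> H; apply/cvgrPdist_le => eps /H; apply: filterS => n /andP[lo hi].
by rewrite ger0_norm ?subr_ge0 // lerBlDr addrC -lerBlDr.
Qed.

Theorem theorem1p15 (R : realType) :
  exists Ctr csp : R, [/\ 0 < Ctr, 0 < csp &
    forall (Omega : nat -> finType) (h : nat -> nat)
           (A : forall n : nat, {set {set Omega n}}) (theta : nat -> R),
      let a := fun n : nat => Pr (percolation (Omega n) (theta n)) (contains_member (A n)) in
      let q := fun n : nat => theta n / a n in
      (forall n : nat, (0 < n)%N -> forall S : {set Omega n}, S \in A n -> #|S| = h n) ->
      h n @[n --> \oo] --> \oo ->
      (forall n : nat, (0 < n)%N -> 0 < theta n <= 1) ->
      (forall n : nat, (0 < n)%N -> 0 < a n) ->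
      (\forall n \near \oo, q n <= 1 / 2) ->
      [/\ (forall n : nat, (0 < n)%N -> supports_spread (A n) (q n)),
          (forall rho : nat -> R,
             (forall n : nat, (0 < n)%N -> 0 < rho n <= 1) ->
             (\forall n \near \oo, 2 * Ctr * q n * ln (h n)%:R <= rho n) ->
             Pr (prod_pmf (uniform_colouring R (Omega n) (h n))
                          (percolation (Omega n) (rho n)))
                (fun z => contains_rainbow (A n) z.1 z.2)
               @[n --> \oo] --> (1 : R)) &
          ((\forall n \near \oo, q n * ln (h n)%:R <= csp) ->
             Pr (uniform_colouring R (Omega n) (h n))
                (fun c => [exists S in A n, rainbow c S])
               @[n --> \oo] --> (1 : R))]].
Proof.
have e0 := expR_gt0 (1 : R).
(* [csp] is the inverse of [2 * Ctr], so that density one satisfies the condition of the second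
   claim. *)
exists (10 * expR 1), (2 * (10 * expR 1))^-1; split.
- by rewrite mulr_gt0.
- by rewrite invr_gt0 !mulr_gt0.
move=> Omega h A theta a q cA hoo theta01 a0 _.
have spr n : (0 < n)%N -> supports_spread (A n) (q n).
  by move=> n0; apply: supports_spread_percolation; [exact: theta01|exact: a0].
have q0 n : (0 < n)%N -> 0 < q n.
  by move=> n0; rewrite divr_gt0 ?a0 //; case/andP: (theta01 n n0).
have hge H : \forall n \near \oo, (H <= h n)%N.
  by exact: (hoo [set k | (H <= k)%N] (nbhs_infty_ge H)).
have n_gt0 : \forall n \near \oo, (0 < n)%N by exact: nbhs_infty_gt.
have col_pmf n : (0 < h n)%N -> is_pmf (uniform_colouring R (Omega n) (h n)).
  exact: uniform_colouring_pmf.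
split=> // [rho rho01 Hrho|Hq]; apply: cvg_Pr1 => eps /rainbow_whp[H HP].
- near=> n.
  have n0 : (0 < n)%N by near: n.
  have rho01n : 0 <= rho n <= 1 by case/andP: (rho01 n n0) => /ltW -> ->.
  apply/andP; split.
    apply: HP rho01n _; [by near: n|exact: cA|exact: spr|exact: q0|].
    by near: n.
  apply: Pr_le1; apply: prod_pmf_pmf; last exact: percolation_pmf.
  by apply: col_pmf; near: n.
near=> n.
have n0 : (0 < n)%N by near: n.
have one01 : 0 <= (1 : R) <= 1 by rewrite ler01 lexx.
have pmfn : is_pmf (uniform_colouring R (Omega n) (h n)) by apply: col_pmf; near: n.
(* The colouring is the first marginal of its product with the percolation of density one, to which
   the percolated bound applies. *)
rewrite Pr_le1 // andbT -(Pr_prod_fst _ _ _ _ (percolation (Omega n) 1));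
  last exact: percolation_pmf.
apply: le_trans (HP (h n) (Omega n) (A n) (q n) 1 _ (cA n n0) (spr n n0) (q0 n n0) one01 _) _.
- by near: n.
- rewrite -mulrA mulrC -ler_pdivlMr ?mulr_gt0 // mul1r.
  by near: n.
apply: Pr_le => [z|[c W] /existsP[S /and3P[SA _ Sc]]].
  by have [] := prod_pmf_pmf pmfn (percolation_pmf (Omega n) one01).
by apply/existsP; exists S; rewrite SA.
Unshelve. all: by end_near.
Qed.
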